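(* Let $G$ be a group and let $R$ be a $G$-graded ring. Suppose that at least one of the following two assertions holds: (i) $R_g r\neq\{0\}$ for all nonzero homogeneous $r\in R$ and all $g\in\operatorname{Supp}(R)$. (ii) $rR_g\neq\{0\}$ for all nonzero homogeneous $r\in R$ and all $g\in\operatorname{Supp}(R)$. If $f$ is a nonzero central idempotent in $R$, then $f$ has finite support group.
   Context: Rings are associative but not necessarily unital and not necessarily commutative. A ring $R$ is $G$-graded if there is a collection of additive subgroups $\{R_g\}_{g\in G}$ of $R$ such that $R=\bigoplus_{g\in G} R_g$ and $R_gR_h\subseteq R_{gh}$ for all $g,h\in G$. An element of $R$ is homogeneous if it lies in $\bigcup_{g\in G}R_g$. We write $\operatorname{Supp}(R)=\{g\in G\mid R_g\neq\{0\}\}$. The support of a nonzero element $r=\sum_{g\in G} r_g$ (with $r_g\in R_g$) is the finite set $\operatorname{Supp}(r)=\{g\in G\mid r_g\neq 0\}$. The support group of $r$ is the subgroup of $G$ generated by $\operatorname{Supp}(r)$. *)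

(* Defs.v *)
From HB Require Import structures.
From mathcomp Require Import all_boot monoid all_algebra.
From mathcomp Require Import boolp classical_sets functions cardinality fsbigop.

Set Implicit Arguments.
Unset Strict Implicit.
Unset Printing Implicit Defensive.

Import GRing.Theory.
Local Open Scope classical_set_scope.

Local Open Scope ring_scope.

(* Associative rings, not necessarily unital or commutative: an additive group
   carrying a semigroup law that distributes over addition. Unlike for
   [pzRingType], the product is the one of [semigroupType], hence written in
   [group_scope]: [(x * y)%g]. *)
HB.mixin Record Zmodule_Semigroup_isRng R of GRing.Zmodule R & Semigroup R := {
  rng_mulDl : left_distributive (@monoid.mul R) +%R;
  rng_mulDr : right_distributive (@monoid.mul R) +%R
}.

#[short(type="rngType")]
HB.structure Definition Rng :=
  {R of GRing.Zmodule R & Semigroup R & Zmodule_Semigroup_isRng R}.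

Definition idempotent_elt (R : rngType) (e : R) : Prop := (e * e)%g = e.

Definition central (R : rngType) (z : R) : Prop := forall x : R, commute z x.

Section Grading.
Variables (G : groupType) (R : rngType).
Implicit Types (A : G -> set R) (r : R) (c : G -> R).

(* The sum ranges over the support of [c], which must be required to be finite:
   [\sum_(g \in D) c g] is 0 by convention when [c] has infinite support. *)
Definition homogeneous_decomposition A r c : Prop :=
  [/\ forall g, A g (c g),
      finite_set [set g | c g != 0] &
      r = \sum_(g \in [set: G]) c g].

(* The second clause says that R is the internal direct sum of the A g. *)
Definition is_grading A : Prop :=
  [/\ forall g, zmod_closed [in A g],
      forall r, exists! c, homogeneous_decomposition A r c &
      forall g h x y, A g x -> A h y -> A (g * h)%g (x * y)%g].

Definition homogeneous A r : Prop := exists g, A g r.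

Definition ring_support A : set G := [set g | A g != [set 0]].

(* Meaningful when [A] is a grading: the family (r_g)_g of components of r. *)
Definition component A r : G -> R :=
  xget (fun=> 0) [set c | homogeneous_decomposition A r c].

Definition elt_support A r : set G := [set g | component A r g != 0].

Definition support_group A r : set G :=
  smallest [set H | group_closed [in H]] (elt_support A r).

End Grading.

(* Main.v *)
From HB Require Import structures.
Require Import Defs.
From mathcomp Require Import all_boot monoid all_order fingroup perm all_algebra.
From mathcomp Require Import boolp classical_sets functions cardinality fsbigop.
From mathcomp Require Import zify.

(** Write f as the sum of its components f_h over its finite support S, and let H
    be the group generated by S.

    Centrality gives f_h * a = a * f_(h ^ g) for a in R_g, and nondegeneracy
    provides an a for which this is nonzero. So conjugation by any g in Supp(R), in
    particular by any g in S, maps S to itself ([support_conj]). Hence H is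
    generated by a finite set that is stable under conjugation by H. By Dietzmann's
    lemma ([dietzmann]) such a group is finite as soon as every generator has
    finite order, and only this has to be proved.

    Suppose that s in S has infinite order. H acts on S by conjugation and the
    kernel is the centre of H, so the centre has finite index and contains a power
    of s, which has infinite order. The rationals being divisible, there is a
    homomorphism from the centre to the rationals that does not vanish on this
    power ([rat_character]). Up to a multiple, a transfer argument extends it to H
    ([transfer_character]); clearing denominators gives a homomorphism phi from H
    to the integers with phi s <> 0 ([integer_character]).

    Such a phi cannot exist ([character_trivial]). Let rho be a representation of
    the integers by unitriangular integer matrices. The sum of the
    f_h rho (phi h) is an idempotent matrix over R whose diagonal entries are all
    equal to the central idempotent f. Its strictly triangular entries vanish, as x
    = 2 f x implies f x = 0 and then x = 0; this is the argument by which a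
    derivation kills a central idempotent, and using all integer matrices instead
    of a single derivation makes it independent of the torsion of R
    ([unitriangular_idempotent]). For rho given by the powers of a large Jordan
    block, whose entries are binomial coefficients, the vanishing says that the
    components of f with the largest positive value of phi add up to 0. As they lie
    in different degrees, each of them is 0, which is absurd; negative values are
    excluded in the same way with - phi. *)

Import Order.TTheory GRing.Theory Num.Theory.
Set Implicit Arguments.
Unset Strict Implicit.
Unset Printing Implicit Defensive.
Local Open Scope classical_set_scope.
Local Open Scope ring_scope.

Lemma finite_set_enum (T : choiceType) (X : set T) : finite_set X ->
  exists2 s : seq T, uniq s & forall x, x \in s <-> X x.
Proof.
move=> /finite_seqP[s ->]; exists (undup s); first exact: undup_uniq.
by move=> x; rewrite mem_undup.
Qed.

Notation generated S := (smallest [set H | group_closed [in H]] [set` S]).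

(** * Groups generated by a finite set stable under conjugation *)

Section Words.
Local Open Scope group_scope.
Variables (G : groupType) (S : seq G).
Hypothesis S_conj : {in S &, forall x s, x ^ s \in S}.

Lemma conjX_mem x s n : x \in S -> s \in S -> x ^ (s ^+ n) \in S.
Proof.
move=> xS sS; elim: n => [|n IHn]; first by rewrite expg0 conjg1.
by rewrite expgSr conjgM S_conj.
Qed.

(** The conjugates x ^ (s ^+ n) of letters of S are letters of S again, so all
    occurrences of s can be pulled to the front of a word without adding or
    losing a letter: moving s past x <> s replaces x by a conjugate of x under a
    power of s, and that conjugate is again different from s. *)
Lemma gather_letter s (w : seq G) : s \in S -> {subset w <= S} ->
  exists w' : seq G, [/\ {subset w' <= S}, (count_mem s w + size w')%N = size w &
    \prod_(x <- w) x = s ^+ count_mem s w * \prod_(x <- w') x].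
Proof.
move=> sS; elim: w => [|x w IHw] wS.
  by exists [::]; split; rewrite //= expg0 mul1g.
have [|w' [w'S sz_w' prod_w]] := IHw.
  by move=> y yw; apply: wS; rewrite inE yw orbT.
have xS : x \in S by apply: wS; rewrite mem_head.
rewrite big_cons prod_w /=; have [->|_] := eqVneq x s.
  by exists w'; split=> //; rewrite ?add1n ?expgS ?mulgA // addSn sz_w'.
exists (x ^ (s ^+ count_mem s w) :: w'); split=> /=.
- by move=> y /[!inE] /predU1P[->|/w'S//]; apply: conjX_mem.
- by rewrite add0n addnS sz_w'.
- by rewrite add0n big_cons 2!mulgA -conjgC.
Qed.

Lemma size_sum_count (w : seq G) : uniq S -> {subset w <= S} ->
  size w = (\sum_(s <- S) count_mem s w)%N.
Proof.
move=> uS; elim: w => [|x w IHw] wS /=; first by rewrite big1.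
rewrite big_split /= -IHw => [|y yw]; last by apply: wS; rewrite inE yw orbT.
suff -> : (\sum_(s <- S) (x == s) = 1)%N by [].
have xS : x \in S by apply: wS; rewrite mem_head.
rewrite (bigD1_seq x) //= eqxx big1 // => s sx.
by rewrite eq_sym (negPf sx).
Qed.

Hypothesis S_torsion : forall s, s \in S -> exists2 n, (0 < n)%N & s ^+ n = 1.

Lemma common_exponent : exists2 m, (0 < m)%N & forall s, s \in S -> s ^+ m = 1.
Proof.
elim: S S_torsion => [|s r IHr] tor; first by exists 1%N.
have [|m m_gt0 mP] := IHr; first by move=> x xr; apply: tor; rewrite inE xr orbT.
have [n n_gt0 sn1] := tor s (mem_head _ _).
exists (m * n)%N; first by rewrite muln_gt0 m_gt0.
move=> x /[!inE] /predU1P[->|/mP xm1]; first by rewrite mulnC expgnA sn1 expg1n.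
by rewrite expgnA xm1 expg1n.
Qed.

(** A word longer than size S * m repeats some letter s at least m times; once
    these copies are gathered, the factor s ^+ m = 1 can be dropped. *)
Lemma short_word m (w : seq G) : uniq S -> (0 < m)%N ->
  (forall s, s \in S -> s ^+ m = 1) -> {subset w <= S} ->
  exists w' : seq G, [/\ {subset w' <= S}, (size w' <= size S * m)%N &
    \prod_(x <- w) x = \prod_(x <- w') x].
Proof.
move=> uS m_gt0 mP.
have [n] := ubnP (size w); elim: n w => // n IHn w szw wS.
have [short|long] := leqP (size w) (size S * m); first by exists w.
have [s sS s_often] : exists2 s, s \in S & (m <= count_mem s w)%N.
  apply: contrapT => no_s; move: long; rewrite ltnNge => /negP[].
  rewrite (size_sum_count uS wS).
  have -> : (size S * m = \sum_(s <- S) m)%N.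
    by rewrite big_const_seq count_predT iter_addn_0 mulnC.
  rewrite big_seq [leqRHS]big_seq; apply: leq_sum => s sS.
  by rewrite leqNgt; apply/negP => lt_m; apply: no_s; exists s => //; apply: ltnW.
have [w' [w'S sz_w' ->]] := gather_letter sS wS.
rewrite -(subnK s_often) addnC expgnDr (mP s sS) mul1g.
have [|x|w'' [w''S sz_w'' eq_w'']] :=
    IHn (nseq (count_mem s w - m) s ++ w').
- by rewrite size_cat size_nseq; lia.
- by rewrite mem_cat => /orP[/nseqP[-> _]//|/w'S].
exists w''; split=> //; rewrite -eq_w'' big_cat /= big_nseq.
by rewrite iter_mulg_1.
Qed.

Fixpoint word_values n : seq G :=
  if n is n'.+1 then word_values n' ++ [seq x * y | x <- S, y <- word_values n']
  else [:: 1].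

Lemma word_valuesP n (w : seq G) : {subset w <= S} -> (size w <= n)%N ->
  \prod_(x <- w) x \in word_values n.
Proof.
elim: n w => [|n IHn] w wS szw.
  by rewrite (size0nil (s := w)) ?big_nil ?inE //; apply/eqP; rewrite -leqn0.
case: w wS szw => [|x w] wS szw.
  by rewrite /= mem_cat IHn.
rewrite big_cons /= mem_cat; apply/orP; right; apply: allpairs_f.
  by apply: wS; rewrite mem_head.
by apply: IHn => // y yw; apply: wS; rewrite inE yw orbT.
Qed.

(** Dietzmann's lemma. Inverses of letters are positive powers of letters, so the
    values of words already form a group, and [short_word] bounds the length of
    the words that are needed. *)
Theorem dietzmann : uniq S -> finite_set (generated S).
Proof.
move=> uS; have [m m_gt0 mP] := common_exponent.
apply: (@sub_finite_set _ _ [set` word_values (size S * m)]); last exact: finite_seq.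
pose W := [set x | exists2 w : seq G, {subset w <= S} & x = \prod_(y <- w) y].
suff WG : group_closed [in W].
  apply: (@subset_trans _ W).
    apply: smallest_sub => // s sS; exists [:: s]; last by rewrite big_seq1.
    by move=> _ /[!inE] /eqP ->.
  move=> _ [w wS ->]; have [w' [w'S sz_w' ->]] := short_word uS m_gt0 mP wS.
  exact: word_valuesP.
have W1 : W 1 by exists [::]; rewrite ?big_nil.
have WM x y : W x -> W y -> W (x * y).
  move=> [w wS ->] [w' w'S ->]; exists (w ++ w'); last by rewrite big_cat.
  by move=> z; rewrite mem_cat => /orP[/wS|/w'S].
have WV x : W x -> W x^-1.
  move=> [w wS ->]; elim: w wS => [|s w IHw] wS; first by rewrite big_nil invg1.
  rewrite big_cons invgM; apply: WM.
    by apply: IHw => y yw; apply: wS; rewrite inE yw orbT.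
  have sS : s \in S by apply: wS; rewrite mem_head.
  exists (nseq m.-1 s); first by move=> y /nseqP[->].
  rewrite big_nseq iter_mulg_1; apply: mulg1_eq.
  by rewrite -expgS prednK // mP.
split; rewrite ?inE // => x y /set_mem Wx /set_mem Wy.
by rewrite inE; apply: WM => //; apply: WV.
Qed.

End Words.

(** * Characters of central-by-finite groups *)

(** The injectivity of the abelian group of rationals, in the case of a cyclic
    subgroup. Let K be maximal among the subgroups meeting the multiples of z
    only in 0. By maximality every x has a nonzero multiple x *~ a congruent
    modulo K to a multiple z *~ i, and psi x is the slope i / a. *)
Lemma rat_character (V : zmodType) (z : V) :
  (forall n, z *+ n = 0 -> n = 0%N) ->
  exists psi : V -> rat, {morph psi : x y / x + y} /\ psi z = 1.
Proof.
move=> z_inf.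
have z_infZ (n : int) : z *~ n = 0 -> n = 0.
  case: n => n; first by move=> /z_inf ->.
  by rewrite NegzE mulrNz => /eqP; rewrite oppr_eq0 => /eqP /z_inf.
pose P (K : set V) := (forall x y, K x -> K y -> K (x - y)) /\
  (forall n : int, K (z *~ n) -> n = 0).
have [|K [[KB Kz] Kmax]] := @Zorn_bigcup V P.
  move=> F FP Ftot; split=> [x y [X FX Xx] [Y FY Yy]|n [X /FP[_ +]]]; last exact.
  have [XY|YX] := Ftot _ _ FX FY.
  - by exists Y => //; apply: (FP _ FY).1 => //; apply: XY.
  - by exists X => //; apply: (FP _ FX).1 => //; apply: YX.
(* The empty set satisfies P, as the union of the empty chain; maximality
   nevertheless forces 0 into K. *)
have K0 : K 0.
  apply: contrapT => nK0; apply: (Kmax [set 0]).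
    split=> [x Kx|/(_ 0 erefl)//].
    by case: nK0; rewrite -(subrr x); apply: KB.
  split=> [x y -> ->|n]; first by rewrite subrr.
  exact: z_infZ.
have KN x : K x -> K (- x) by move=> Kx; rewrite -sub0r; apply: KB.
have KD x y : K x -> K y -> K (x + y).
  by move=> Kx Ky; rewrite -[y]opprK; apply: KB => //; apply: KN.
have KM x (n : int) : K x -> K (x *~ n).
  have Kn k : K x -> K (x *+ k).
    by move=> Kx; elim: k => [|k IHk]; rewrite ?mulr0n // mulrS; apply: KD.
  move=> Kx; case: n => n; first exact: Kn.
  by rewrite NegzE mulrNz; apply/KN/Kn.
have root x : exists p : int * int, p.1 != 0 /\ K (x *~ p.1 - z *~ p.2).
  have [Kx|nKx] := pselect (K x).
    by exists (1, 0); rewrite subr0.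
  apply: contrapT => no_p.
  apply: (Kmax [set y | exists n : int, K (y - x *~ n)]).
    split=> [y Ky|]; first by exists 0; rewrite subr0.
    by move=> sub; apply: nKx; apply: sub; exists 1; rewrite subrr.
  split=> [y y' [n Kn] [n' Kn']|n [m Km]].
    exists (n - n'); have := KB _ _ Kn Kn'.
    by rewrite mulrzBr !opprB addrACA [in X in _ -> X]addrACA (addrC (- y')).
  have [m0|m_neq0] := eqVneq m 0; first by apply: Kz; rewrite m0 subr0 in Km.
  by case: no_p; exists (m, n); split=> //=; rewrite -opprB; apply: KN.
(* The slope i / a is the same for all the congruences that x satisfies. *)
have slope x (a i b j : int) :
    K (x *~ a - z *~ i) -> K (x *~ b - z *~ j) -> a * j = b * i.
  move=> Ka Kb; apply/eqP; rewrite -subr_eq0; apply/eqP/Kz.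
  have := KB _ _ (KM _ b Ka) (KM _ a Kb).
  rewrite !mulrzBl -!mulrzA opprB (mulrC b a) addrC subrKA mulrzBr.
  by rewrite (mulrC j) (mulrC i).
have /choice[p pP] := root.
have psiP x (a i : int) : a != 0 -> K (x *~ a - z *~ i) ->
    (p x).2%:~R / (p x).1%:~R = i%:~R / a%:~R :> rat.
  have [p_neq0 Kp] := pP x; move=> a_neq0 Ka.
  apply/eqP; rewrite eqr_div ?intr_eq0 // -!intrM eqr_int.
  by rewrite mulrC (slope _ _ _ _ _ Ka Kp) mulrC.
exists (fun x => (p x).2%:~R / (p x).1%:~R); split=> [x y|]; last first.
  by rewrite (psiP z 1 1) // subrr.
have [[px_neq0 Kx] [py_neq0 Ky]] := (pP x, pP y).
rewrite (psiP _ ((p x).1 * (p y).1) ((p x).2 * (p y).1 + (p y).2 * (p x).1)).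
- by rewrite intrD !intrM addf_div ?intr_eq0.
- by rewrite mulf_neq0.
have := KD _ _ (KM _ (p y).1 Kx) (KM _ (p x).1 Ky).
rewrite !mulrzBl -!mulrzA addrACA -opprD -mulrzDr [(p y).1 * _]mulrC.
by rewrite -mulrzDl.
Qed.

Section RationalCharacters.
Local Open Scope group_scope.

Lemma subgroup_character (G : groupType) (A : set G) (z : G) :
    group_closed [in A] -> {in A &, forall x y, commute x y} -> z \in A ->
    (forall n, z ^+ n = 1 -> n = 0%N) ->
  exists psi : G -> rat,
    {in A &, {morph psi : x y / x * y >-> (x + y)%R}} /\ psi z = 1%R.
Proof.
move=> Agrp Acomm zA z_inf.
have [[A1 AM] AV] := (Agrp.1, group_closedM Agrp, group_closedV Agrp).
pose T := {x : G | x \in A}.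
pose add (x y : T) : T := exist _ (val x * val y) (AM _ _ (valP x) (valP y)).
pose opp (x : T) : T := exist _ (val x)^-1 (AV _ (valP x)).
pose zero : T := exist _ 1 A1.
have addA : associative add by move=> x y t; apply: val_inj; apply: mulgA.
have addC : commutative add.
  by move=> x y; apply: val_inj; apply: Acomm; apply: valP.
have add0 : left_id zero add by move=> x; apply: val_inj; apply: mul1g.
have addN : left_inverse zero opp add by move=> x; apply: val_inj; apply: mulVg.
pose V : zmodType := HB.pack T (GRing.isZmodule.Build T addA addC add0 addN).
have val_mulrn (x : V) n : val (x *+ n)%R = val x ^+ n.
  by elim: n => // n IHn; rewrite mulrS expgS -IHn.
have [|psi [psiD psi_z]] := @rat_character V (exist _ z zA).
  by move=> n zn0; apply: z_inf; have := val_mulrn (exist _ z zA) n; rewrite zn0 => /esym.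
exists (fun x => if insub x is Some y then psi y else 0%R).
split=> [x y xA yA|]; last by rewrite insubT.
rewrite !insubT ?AM // => xyA; rewrite -psiD; congr psi; exact: val_inj.
Qed.

(** A rational character psi of a central subgroup A of finite index extends to H
    up to a positive multiple. Choosing representatives of the cosets of A yields a
    map theta with theta (x * a) = theta x + psi a for a in A; the increment
    y |-> theta (x * y) - theta y is therefore constant on the cosets y A, and its
    sum over H / A is additive in x because translation permutes the cosets. The
    finite index is encoded by a map p to a finite group with kernel A. *)
Lemma transfer_character (G : groupType) (gT : finGroupType) (p : G -> gT)
    (H A : set G) (psi : G -> rat) :
    group_closed [in H] -> group_closed [in A] ->
    {in A, forall a, a \in H /\ {in H, forall x, commute a x}} ->
    {in H &, {morph p : x y / x * y}} ->
    {in H, forall x, p x = 1 <-> x \in A} ->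
    {in A &, {morph psi : x y / x * y >-> (x + y)%R}} ->
  exists phi : G -> rat, {in H &, {morph phi : x y / x * y >-> (x + y)%R}} /\
    exists2 n, (0 < n)%N & {in A, forall a, phi a = (psi a *+ n)%R}.
Proof.
move=> Hgrp Agrp AcentH pM kerp psiM.
have [[H1 HM] HV] := (Hgrp.1, group_closedM Hgrp, group_closedV Hgrp).
have AH a : a \in A -> a \in H by move=> /AcentH[].
pose im i := `[< exists2 x, x \in H & p x = i >].
have /choice[rep repP] i : exists x, im i -> x \in H /\ p x = i.
  have [[x xH <-]|no_x] := pselect (exists2 x, x \in H & p x = i).
    by exists x.
  by exists 1 => /asboolP.
have imp x : x \in H -> im (p x) by move=> xH; apply/asboolP; exists x.
have repH x : x \in H -> rep (p x) \in H by move=> /imp /repP[].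
have p1 : p 1 = 1 by apply: (mulgI (p 1)); rewrite -pM // !mulg1.
have pV x : x \in H -> p x^-1 = (p x)^-1.
  move=> xH; apply: (mulgI (p x)); rewrite -pM ?HV // mulgV p1.
  by rewrite mulgV.
pose theta x := psi ((rep (p x))^-1 * x).
have kerp1 x xH := (kerp x xH).1.
have fibreA x y : x \in H -> y \in H -> p x = p y -> x^-1 * y \in A.
  move=> xH yH pxy; apply: kerp1; first by rewrite HM ?HV.
  by rewrite pM ?HV // pV // pxy mulVg.
have repA x : x \in H -> (rep (p x))^-1 * x \in A.
  by move=> xH; apply: fibreA; rewrite ?repH // (repP _ (imp _ xH)).2.
have pA a x : a \in A -> x \in H -> p (x * a) = p x.
  by move=> aA xH; rewrite pM ?(AH a aA) // ((kerp a (AH a aA)).2 aA) mulg1.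
have thetaA x a : x \in H -> a \in A -> theta (x * a) = (theta x + psi a)%R.
  by move=> xH aA; rewrite /theta pA // mulgA psiM // repA.
pose phi x := (\sum_(i | im i) (theta (x * rep i)%g - theta (rep i)))%R.
exists phi; split=> [x y xH yH|].
  have -> : phi x = (\sum_(i | im i) (theta (x * (y * rep i))%g - theta (y * rep i)%g))%R.
    have im_y i : im (p y * i) = im i.
      apply/asboolP/asboolP => -[t tH pt].
        by exists (y^-1 * t); rewrite ?HM ?HV // pM ?HV // pV // pt mulKg.
      by exists (y * t); rewrite ?HM // pM // pt.
    rewrite /phi (reindex_inj (mulgI (p y))) /=; apply: eq_big => // i im_yi.
    have [rH pr] := repP _ im_yi; rewrite im_y in im_yi.
    have [iH p_i] := repP _ im_yi.
    have yiH : y * rep i \in H by rewrite HM.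
    have aA : (rep (p y * i))^-1 * (y * rep i) \in A.
      by apply: fibreA; rewrite // pr pM // p_i.
    rewrite -[y * rep i](mulVKg (rep (p y * i))) [x * (_ * _)]mulgA.
    by rewrite (thetaA (x * _)) ?HM // (thetaA (rep _)) // opprD addrACA subrr addr0.
  rewrite /phi -big_split /=; apply: eq_bigr => i _.
  by rewrite mulgA subrKA.
have im1 : (0 < #|[pred i | im i]|)%N.
  by apply/card_gt0P; exists (p 1); exact: (imp 1 H1).
exists #|[pred i | im i]| => // a aA.
rewrite /phi -sumr_const; apply: eq_bigr => i /repP[iH _].
have [_ aC] := AcentH a aA; rewrite (aC _ iH) thetaA //.
by rewrite addrC addKr.
Qed.

End RationalCharacters.

Section ConjugationActions.
Local Open Scope group_scope.

(** Conjugation by s is injective, hence a permutation of the finite set S as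
    soon as it maps S to itself. *)
Lemma conjV_mem (G : groupType) (S : seq G) s : {in S, forall x, x ^ s \in S} ->
  {in S, forall x, x ^ s^-1 \in S}.
Proof.
move=> S_conj x xS; have uconj : uniq [seq y ^ s | y <- undup S].
  by rewrite map_inj_uniq ?undup_uniq //; exact: conjg_inj.
have sub : {subset [seq y ^ s | y <- undup S] <= undup S}.
  by move=> _ /mapP[y + ->]; rewrite !mem_undup => yS; apply: S_conj.
have [] := uniq_min_size uconj sub; first by rewrite size_map.
move=> _ /(_ x); rewrite mem_undup xS => /mapP[y + ->].
by rewrite mem_undup conjgK.
Qed.

Section IntegerCharacter.
Variables (G : groupType) (S : seq G).
Hypothesis S_conj : {in S &, forall x s, x ^ s \in S}.
Let H := generated S.

Lemma generated_group : group_closed [in H].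
Proof.
split=> [|x y /set_mem xH /set_mem yH]; rewrite inE => K KP.
  by apply/set_mem; case: KP => -[].
have [KG _] := KP; apply/set_mem/KG.2; apply/mem_set; first exact: xH.
exact: yH.
Qed.

Lemma generated_ind (P : set G) : group_closed [in P] -> {in S, forall s, P s} ->
  {in H, forall x, P x}.
Proof. by move=> PG SP x /set_mem; apply; split=> // s /SP. Qed.

Lemma mem_generated : {in S, forall s, s \in H}.
Proof. by move=> s sS; rewrite inE; apply: sub_gen_smallest. Qed.

Lemma conj_generated x y : x \in S -> y \in H -> x ^ y \in S.
Proof.
move=> xS yH; pose N := [set y | forall x, x \in S -> x ^ y \in S /\ x ^ y^-1 \in S].
suff: N y by case/(_ x xS).
move: y yH; apply: generated_ind => [|s sS t tS]; last first.
  split; first exact: S_conj.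
  by apply: conjV_mem => // y yS; apply: S_conj.
split=> [|u v /set_mem uN /set_mem vN]; rewrite inE => t tS.
  by rewrite invg1 conjg1.
rewrite invgM invgK !conjgM; split; first by have [_] := vN _ (uN t tS).1.
by have [_ ] := uN _ (vN t tS).1.
Qed.

(* The dummy action of the elements outside H makes act x injective for all x. *)
Let act x (t : seq_sub S) := insubd t (if x \in H then val t ^ x else val t).

Lemma val_act x t : x \in H -> val (act x t) = val t ^ x.
Proof. by move=> xH; rewrite /act xH val_insubd conj_generated // (valP t). Qed.

Lemma act_inj x : injective (act x).
Proof.
move=> t u; case: (boolP (x \in H)) => [xH /(congr1 val)|/negPf xH].
  by rewrite !val_act // => /conjg_inj /val_inj.
by rewrite /act xH !valKd.
Qed.

Let p x := perm (@act_inj x).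

(** H acts on the finite set S by conjugation with kernel the centre A of H, so A
    has finite index and some power of s is in A. A rational character of A that
    does not vanish on this power is transferred to H; its values on the
    generators have a common denominator q. *)
Lemma integer_character s : s \in S -> (forall n, s ^+ n = 1 -> n = 0%N) ->
  exists phi : G -> int,
    {in H &, {morph phi : x y / x * y >-> (x + y)%R}} /\ phi s != 0%R.
Proof.
move=> sS s_inf; have sH := mem_generated sS.
have HG := generated_group.
have [HM HV] := (group_closedM HG, group_closedV HG).
have pM : {in H &, {morph p : x y / x * y}}.
  move=> x y xH yH; apply/permP => t; apply: val_inj.
  by rewrite permM !permE !val_act ?HM // conjgM.
pose A := [set x | x \in H /\ {in H, forall y, commute x y}].
have AG : group_closed [in A].
  split=> [|x y /set_mem[xH xC] /set_mem[yH yC]]; rewrite inE.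
    by split=> [|y yH]; [case: HG | apply/commute_sym/commute1].
  split; first by case: HG => _; apply.
  move=> t tH; apply/commute_sym/commuteM; first by apply/commute_sym/xC.
  by apply/commuteV/commute_sym/yC.
have kerp : {in H, forall x, p x = 1 <-> x \in A}.
  move=> x xH; split=> [px1|/set_mem[_ xC]].
    rewrite inE; split=> //; apply: (@generated_ind [set y | commute x y]).
      split=> [|y t /set_mem xy /set_mem xt]; rewrite inE; first exact: commute1.
      by apply: commuteM => //; apply: commuteV.
    move=> t tS /=; have xt : t ^ x = t.
      have := congr1 (fun q : {perm _} => val (q (SeqSub tS))) px1.
      by rewrite permE val_act // perm1.
    by rewrite /commute [RHS]conjgC xt.
  apply/permP => t; apply: val_inj; rewrite permE val_act // perm1.
  by rewrite conjgE -xC ?mulKg // mem_generated // (valP t).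
have sXH n : s ^+ n \in H.
  by elim: n => [|n IHn]; [case: HG | rewrite expgS HM].
have pX n : p (s ^+ n) = p s ^+ n.
  elim: n => [|n IHn]; last by rewrite !expgS pM // IHn.
  apply/permP => t; apply: val_inj.
  by rewrite permE val_act ?(sXH 0) // !expg0 conjg1 perm1.
set n := #[p s]%g; have n_gt0 : (0 < n)%N := order_gt0 _.
have zA : s ^+ n \in A by apply/kerp; rewrite // pX expg_order.
have [||psi [psiM psi_z]] := subgroup_character AG _ zA.
- by move=> x y /set_mem[_ xC] /set_mem[yH _]; apply: xC.
- by move=> k; rewrite -expgnA => /s_inf /eqP; rewrite muln_eq0 gtn_eqF //= => /eqP.
have [|phi [phiM [c c_gt0 phiA]]] := transfer_character HG AG _ pM kerp psiM.
  by move=> x /set_mem.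
have phi1 : phi 1 = 0%R.
  have := phiM 1 1 HG.1 HG.1; rewrite mulg1 => /esym/eqP.
  by rewrite -subr_eq0 addrK => /eqP.
have phiX k : phi (s ^+ k) = (phi s *+ k)%R.
  by elim: k => [|k IHk]; rewrite ?expg0 ?phi1 // expgS phiM // IHk mulrS.
have phi_s : phi s != 0%R.
  apply/eqP => phi_s0; have := phiA _ zA; rewrite phiX phi_s0 mul0rn psi_z.
  by move/esym/eqP; rewrite pnatr_eq0 gtn_eqF.
pose q : rat := (\prod_(t <- S) (denq (phi t))%:~R)%R.
have q_neq0 : q != 0%R.
  by rewrite /q prodf_seq_neq0; apply/allP => t _ /=; rewrite intr_eq0 denq_eq0.
have phi_int : {in H, forall x, (phi x * q)%R \is a Num.int}.
  pose P := [set x | x \in H /\ (phi x * q)%R \is a Num.int].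
  suff: {in H, forall x, P x} by move=> HP x /HP[].
  apply: generated_ind => [|t tS].
    split=> [|x y /set_mem[xH xZ] /set_mem[yH yZ]]; rewrite inE.
      by split; [case: HG | rewrite phi1 mul0r].
    split; first by case: HG => _; apply.
    have -> : phi (x / y) = (phi x - phi y)%R.
      have /phiM/(_ yH) : x / y \in H by case: HG => _; apply.
      by rewrite mulgVK => ->; rewrite addrK.
    by rewrite mulrBl rpredB.
  split; first exact: mem_generated.
  rewrite /q (big_rem t) //= mulrA -numqE.
  by rewrite rpredM ?intr_int // rpred_prod // => u _; apply: intr_int.
exists (fun x => Num.floor (phi x * q)%R); split=> [x y xH yH|].
  apply: (@intr_inj rat); rewrite rmorphD /= !floorK ?phi_int ?HM //.
  by rewrite phiM // mulrDl.
rewrite -(intr_eq0 rat) floorK ?phi_int //.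
by rewrite mulf_neq0.
Qed.

End IntegerCharacter.

End ConjugationActions.

(** * Components in a graded ring *)

Section RngTheory.
Variable R : rngType.
Implicit Types x y : R.

(** Multiplication with the varying factor last, so that the two partial
    applications carry a structure of additive map. *)
Definition lmul x y : R := (x * y)%g.
Definition rmul y x : R := (x * y)%g.

Lemma lmul_is_zmod_morphism x : zmod_morphism (lmul x).
Proof.
move=> y z; apply/eqP; rewrite -subr_eq opprK; apply/eqP.
by rewrite /lmul -rng_mulDr subrK.
Qed.
HB.instance Definition _ x :=
  GRing.isZmodMorphism.Build R R (lmul x) (lmul_is_zmod_morphism x).

Lemma rmul_is_zmod_morphism y : zmod_morphism (rmul y).
Proof.
move=> x z; apply/eqP; rewrite -subr_eq opprK; apply/eqP.
by rewrite /rmul -rng_mulDl subrK.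
Qed.
HB.instance Definition _ y :=
  GRing.isZmodMorphism.Build R R (rmul y) (rmul_is_zmod_morphism y).

Lemma rng_mul0 x : (0 * x)%g = 0 :> R. Proof. exact: (raddf0 (rmul x)). Qed.
Lemma rng_mulr0 x : (x * 0)%g = 0 :> R. Proof. exact: (raddf0 (lmul x)). Qed.

Lemma rng_sumr x I (r : seq I) (F : I -> R) :
  (x * \sum_(i <- r) F i)%g = \sum_(i <- r) (x * F i)%g.
Proof. exact: (raddf_sum (lmul x)). Qed.

Lemma rng_suml x I (r : seq I) (F : I -> R) :
  ((\sum_(i <- r) F i) * x)%g = \sum_(i <- r) (F i * x)%g.
Proof. exact: (raddf_sum (rmul x)). Qed.

Lemma rng_mulz x y (m n : int) : (x *~ m * (y *~ n))%g = (x * y)%g *~ (m * n).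
Proof.
rewrite [LHS](raddfMz (lmul (x *~ m)) n) mulrzA; congr (_ *~ _).
exact: (raddfMz (rmul y) m).
Qed.

End RngTheory.

Section Grading.
Variables (G : groupType) (R : rngType) (A : G -> set R).
Hypothesis grA : is_grading A.
Implicit Types (r x y : R) (g h : G).

Lemma graded0 g : A g 0.
Proof. by have [/(_ g)[A0 _] _ _] := grA; apply: set_mem A0. Qed.

Lemma gradedB g x y : A g x -> A g y -> A g (x - y).
Proof.
have [/(_ g)[_ AB] _ _ Ax Ay] := grA.
by apply/set_mem; apply: AB; apply/mem_set.
Qed.

Lemma gradedD g x y : A g x -> A g y -> A g (x + y).
Proof.
move=> Ax Ay; rewrite -[y]opprK; apply: gradedB => //.
by rewrite -sub0r; apply: gradedB => //; apply: graded0.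
Qed.

Lemma gradedM g h x y : A g x -> A h y -> A (g * h)%g (x * y)%g.
Proof. by have [_ _] := grA; apply. Qed.

Lemma component_decomposition r : homogeneous_decomposition A r (component A r).
Proof.
have [_ /(_ r)[c [cP _]] _] := grA.
by apply: xgetPex; exists c.
Qed.

Lemma component_unique r c :
  homogeneous_decomposition A r c -> component A r = c.
Proof.
have [_ /(_ r)[c' [_ c'_uniq]] _] := grA => cP.
by rewrite -(c'_uniq _ cP) -(c'_uniq _ (component_decomposition r)).
Qed.

Lemma component_graded r g : A g (component A r g).
Proof. by have [] := component_decomposition r. Qed.

Lemma finite_elt_support r : finite_set (elt_support A r).
Proof. by have [] := component_decomposition r. Qed.

Lemma fsumE (V : zmodType) (s : seq G) (F : G -> V) :
  uniq s -> (forall g, F g != 0 -> g \in s) ->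
  \sum_(g \in [set: G]) F g = \sum_(g <- s) F g.
Proof.
move=> us Fs; rewrite (fsbigE s) // => [|g _ gs]; last first.
  by apply: contraNeq gs; apply: Fs.
by apply: eq_bigl => g; rewrite mem_set.
Qed.

Lemma sum_component r (s : seq G) :
  uniq s -> (forall g, elt_support A r g -> g \in s) ->
  r = \sum_(g <- s) component A r g.
Proof.
by move=> us rs; have [_ _ {1}->] := component_decomposition r; apply: fsumE.
Qed.

Lemma component_homogeneous g x : A g x ->
  component A x = fun h => if h == g then x else 0.
Proof.
move=> Ax; apply: component_unique; split=> [h||].
- by case: eqP => [->|_] //; apply: graded0.
- apply: (@sub_finite_set _ _ [set g]); last exact: finite_set1.
  by move=> h /=; case: (h =P g); rewrite ?eqxx.
- rewrite (fsumE (s := [:: g])) // ?big_seq1 ?eqxx // => h.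
  by rewrite inE; case: (h == g); rewrite ?eqxx.
Qed.

Lemma componentD x y g :
  component A (x + y) g = component A x g + component A y g.
Proof.
have fin : finite_set (elt_support A x `|` elt_support A y).
  by rewrite finite_setU; split; apply: finite_elt_support.
have [s us sP] := finite_set_enum fin.
have sumP h : component A x h + component A y h != 0 -> h \in s.
  move=> xy0; apply/sP; have [x0|?] := eqVneq (component A x h) 0; last by left.
  by right; rewrite x0 add0r in xy0.
suff -> : component A (x + y) = fun h => component A x h + component A y h by [].
apply: component_unique; split=> [h||].
- by apply: gradedD; apply: component_graded.
- by apply: (@sub_finite_set _ _ [set` s]); [exact: sumP | exact: finite_seq].
rewrite (fsumE us sumP) big_split /= -!sum_component // => h hP; apply/sP.
  by right.
by left.
Qed.

(** These maps are additive and act on A g as multiplication by w g, so that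
    applying one of them to an identity in R gives an identity between components;
    indicator weights give the projections. *)
Definition weighted (w : G -> int) r := \sum_(g \in [set: G]) component A r g *~ w g.

Lemma weightedE w r (s : seq G) :
  uniq s -> (forall g, elt_support A r g -> g \in s) ->
  weighted w r = \sum_(g <- s) component A r g *~ w g.
Proof.
move=> us rs; apply: fsumE => // g rg0; apply: rs; apply: contraNneq rg0 => ->.
by rewrite mul0rz.
Qed.

Lemma weightedD w : {morph weighted w : x y / x + y}.
Proof.
move=> x y; have fin : finite_set
    (elt_support A x `|` elt_support A y `|` elt_support A (x + y)).
  by rewrite !finite_setU; do !split; apply: finite_elt_support.
have [s us sP] := finite_set_enum fin.
have [xs ys xys] : [/\ forall g, elt_support A x g -> g \in s,
    forall g, elt_support A y g -> g \in s &
    forall g, elt_support A (x + y) g -> g \in s].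
  by split=> g ?; apply/sP; [left; left | left; right | right].
rewrite !(@weightedE _ _ s) //.
by rewrite -big_split; apply: eq_bigr => g _; rewrite componentD mulrzDl.
Qed.

Lemma weighted0 w : weighted w 0 = 0.
Proof. by apply: (addrI (weighted w 0)); rewrite -weightedD !addr0. Qed.

Lemma weighted_sum w I (s : seq I) (F : I -> R) :
  weighted w (\sum_(i <- s) F i) = \sum_(i <- s) weighted w (F i).
Proof. exact: (big_morph _ (@weightedD w) (weighted0 w)). Qed.

Lemma weighted_homogeneous w g x : A g x -> weighted w x = x *~ w g.
Proof.
move=> Ax; rewrite (@weightedE _ _ [:: g]) // ?big_seq1.
  by rewrite (component_homogeneous Ax) eqxx.
move=> h; rewrite /elt_support /= (component_homogeneous Ax) inE.
by case: (h == g); rewrite ?eqxx.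
Qed.

End Grading.

Section Multiplication.
Variables (G : groupType) (R : rngType) (A : G -> set R).
Hypothesis grA : is_grading A.

Lemma component_indicator r u :
  component A r u = weighted A (fun g => (g == u)%:R) r.
Proof.
have [s us sP] := finite_set_enum (finite_set1 u); rewrite /weighted.
rewrite (fsumE (s := [:: u])) ?big_seq1 ?eqxx // => g.
by rewrite inE; case: (g == u); rewrite // mulr0z eqxx.
Qed.

Lemma component_mull r a g h : A g a ->
  component A (a * r)%g (g * h)%g = (a * component A r h)%g.
Proof.
move=> Aa; have fin : finite_set (elt_support A r `|` [set h]).
  by rewrite finite_setU; split; [exact: finite_elt_support | exact: finite_set1].
have [s us sP] := finite_set_enum fin.
rewrite component_indicator {1}(sum_component grA (r := r) us) => [|k rk]; last first.
  by apply/sP; left.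
rewrite rng_sumr weighted_sum // (bigD1_seq h) //=; last by apply/sP; right.
rewrite big1 => [|k kh];
  rewrite (weighted_homogeneous grA _ (gradedM grA Aa (component_graded grA r _))).
  by rewrite eqxx addr0.
by rewrite (inj_eq (mulgI g)) (negPf kh).
Qed.

Lemma component_mulr r a g h : A g a ->
  component A (r * a)%g (h * g)%g = (component A r h * a)%g.
Proof.
move=> Aa; have fin : finite_set (elt_support A r `|` [set h]).
  by rewrite finite_setU; split; [exact: finite_elt_support | exact: finite_set1].
have [s us sP] := finite_set_enum fin.
rewrite component_indicator {1}(sum_component grA (r := r) us) => [|k rk]; last first.
  by apply/sP; left.
rewrite rng_suml weighted_sum // (bigD1_seq h) //=; last by apply/sP; right.
rewrite big1 => [|k kh];
  rewrite (weighted_homogeneous grA _ (gradedM grA (component_graded grA r _) Aa)).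
  by rewrite eqxx addr0.
by rewrite (inj_eq (mulIg g)) (negPf kh).
Qed.

(** Both sides are the component of f * a = a * f in degree h * g = g * h ^ g. *)
Lemma central_component f a g h : central f -> A g a ->
  (component A f h * a)%g = (a * component A f (h ^ g)%g)%g.
Proof.
move=> fC Aa; rewrite -(component_mulr _ _ Aa) -(component_mull _ _ Aa).
by rewrite fC -conjgC.
Qed.

Lemma elt_support_ring_support f : elt_support A f `<=` ring_support A.
Proof.
move=> g /eqP fg; apply/eqP => Ag; apply: fg.
by have := component_graded grA f g; rewrite Ag.
Qed.

End Multiplication.

(** * Unitriangular integer matrices *)

Section Unitriangular.
Variable n : nat.
Implicit Types M N : 'M[int]_n.

Definition unitriangular M := forall i j : 'I_n, (i <= j)%N -> M i j = (i == j)%:R.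

Lemma unitriangular1 : unitriangular 1%:M.
Proof. by move=> i j _; rewrite mxE. Qed.

Lemma unitriangular_mul M N :
  unitriangular M -> unitriangular N -> unitriangular (M *m N).
Proof.
move=> UM UN i j le_ij; rewrite mxE (bigD1 j) //= big1 ?addr0 => [|k kj].
  by rewrite UN // eqxx mulr1 UM.
have [le_kj|lt_jk] := leqP k j; first by rewrite UN // (negPf kj) mulr0.
rewrite UM; last exact/ltnW/(leq_ltn_trans le_ij).
have -> : (i == k) = false by rewrite -val_eqE /=; lia.
by rewrite mul0r.
Qed.

Lemma unitriangular_inv M N : unitriangular M -> M *m N = 1%:M -> unitriangular N.
Proof.
move=> UM MN1 i; have [d] := ubnP i; elim: d i => // d IHd i lt_d j le_ij.
have := congr1 (fun K : 'M_n => K i j) MN1.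
rewrite !mxE (bigD1 i) //= big1 ?addr0 => [|k ki]; first by rewrite UM // eqxx mul1r.
have [lt_ki|le_ik] := ltnP k i.
  rewrite IHd; try lia.
  have -> : (k == j) = false by rewrite -val_eqE /=; lia.
  by rewrite mulr0.
by rewrite UM // eq_sym (negPf ki) mul0r.
Qed.

Lemma unitriangular_unit M : unitriangular M -> M \in unitmx.
Proof.
move=> UM; rewrite unitmxE det_trig; last first.
  apply/is_trig_mxP => i j lt_ij; rewrite UM ?(ltnW lt_ij) //.
  by rewrite -val_eqE /= (ltn_eqF lt_ij).
by rewrite big1 ?unitr1 // => i _; rewrite UM ?eqxx.
Qed.

End Unitriangular.

Lemma unitriangular_expz n (M : 'M[int]_n.+1) (k : int) :
  unitriangular M -> unitriangular (M ^ k).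
Proof.
move=> UM; have UX m : unitriangular (M ^+ m).
  elim: m => [|m IHm]; first exact: unitriangular1.
  by rewrite exprS; apply: unitriangular_mul.
case: k => m; first exact: UX.
apply: (unitriangular_inv (UX m.+1)); apply: mulmxV.
exact/unitriangular_unit.
Qed.

Definition jordan n : 'M[int]_n := \matrix_(i, j) ((i == j) || (i == j.+1 :> nat))%:R.

Lemma unitriangular_jordan n : unitriangular (jordan n).
Proof.
move=> i j le_ij; rewrite mxE.
have -> : (i == j.+1 :> nat) = false by lia.
by rewrite orbF.
Qed.

(** The first column of the k-th power is the k-th row of Pascal's triangle, of
    which only the final 1, in row k, and the zeros below it are needed. *)
Lemma jordan_expr n k (i : 'I_n.+1) : (k <= i)%N ->
  (jordan n.+1 ^+ k) i ord0 = (i == k :> nat)%:R.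
Proof.
elim: k i => [|k IHk] i le_ki; first by rewrite expr0 mxE.
rewrite exprS mxE.
have i_gt0 : (0 < i)%N by apply: leq_ltn_trans le_ki.
have lt_i : (i.-1 < n.+1)%N by apply: leq_ltn_trans (leq_pred i) (ltn_ord i).
pose i' := Ordinal lt_i.
have ne : i' != i by rewrite -(inj_eq val_inj) /=; lia.
rewrite (bigD1 i) //= (bigD1 i') //= big1 ?addr0 => [|j /andP[ji ji']].
  rewrite IHk; last lia.
  rewrite IHk /=; last lia.
  rewrite !mxE /=.
  have -> : (i == k :> nat) = false by lia.
  have -> : (i == i') = false by apply/negbTE; rewrite eq_sym.
  by rewrite mulr0 add0r prednK // eqxx mul1r -[in RHS](prednK i_gt0) eqSS.
rewrite mxE eq_sym (negPf ji); case: eqP => [ij|_]; last by rewrite mul0r.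
by case/negP: ji'; rewrite -(inj_eq val_inj) /= ij.
Qed.

(** * Central idempotents and characters *)

Section CentralIdempotents.
Variables (G : groupType) (R : rngType) (A : G -> set R).
Hypothesis grA : is_grading A.
Variables (f : R) (s : seq G).
Hypotheses (f_central : central f) (f_idem : idempotent_elt f).
Hypotheses (us : uniq s) (sP : forall g, g \in s <-> elt_support A f g).

Notation c := (component A f).

Let f_sum : f = \sum_(g <- s) c g.
Proof. by apply: sum_component => // g /sP. Qed.

(** The matrix L of sums on the left is idempotent because f is, with diagonal
    entries f and zeros above the diagonal. Going down the subdiagonals, all the
    other terms in the expansion of an entry x of L * L vanish and leave
    x = f * x + f * x; multiplying by f gives f * x = 0, hence x = 0. *)
Lemma unitriangular_idempotent n (rho : G -> 'M[int]_n) :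
    {in s &, {morph rho : g h / (g * h)%g >-> g *m h}} ->
    {in s, forall g, unitriangular (rho g)} ->
  forall i j, \sum_(g <- s) c g *~ rho g i j = f *~ (i == j)%:R.
Proof.
move=> rhoM rhoU.
pose L i j := \sum_(g <- s) c g *~ rho g i j.
have LM i j : L i j = \sum_k (L i k * L k j)%g.
  have -> : L i j = weighted A (fun g => rho g i j) f.
    by rewrite (weightedE _ us) // => g /sP.
  rewrite -[in LHS]f_idem {1 2}f_sum rng_suml weighted_sum //.
  have -> : \sum_k (L i k * L k j)%g =
      \sum_k \sum_(g <- s) \sum_(h <- s) (c g * c h)%g *~ (rho g i k * rho h k j).
    apply: eq_bigr => k _; rewrite rng_suml; apply: eq_bigr => g _.
    by rewrite rng_sumr; apply: eq_bigr => h _; rewrite rng_mulz.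
  rewrite exchange_big /= big_seq [RHS]big_seq; apply: eq_bigr => g gs.
  rewrite rng_sumr weighted_sum // exchange_big /= big_seq [RHS]big_seq.
  apply: eq_bigr => h hs.
  have cgh := gradedM grA (component_graded grA f g) (component_graded grA f h).
  rewrite (weighted_homogeneous grA _ cgh).
  by rewrite rhoM // mxE mulrz_sumr.
have L_upper (i j : 'I_n) : (i <= j)%N -> L i j = f *~ (i == j)%:R.
  move=> le_ij; rewrite [in RHS]f_sum mulrz_suml /L big_seq [RHS]big_seq.
  by apply: eq_bigr => g gs; rewrite rhoU.
suff L_lower d (i j : 'I_n) : (j < i)%N -> (i - j < d)%N -> L i j = 0.
  move=> i j; have [le_ij|lt_ji] := leqP i j; first exact: L_upper.
  have -> : (i == j) = false by rewrite -val_eqE /= gtn_eqF.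
  by rewrite mulr0z; apply: L_lower lt_ji (ltnSn _).
elim: d i j => // d IHd i j lt_ji lt_d.
have ne_ji : j != i by rewrite -val_eqE /= ltn_eqF.
have L2 : L i j = (f * L i j)%g + (f * L i j)%g.
  rewrite {1}LM (bigD1 i) //= (bigD1 j) //= (L_upper i i) // (L_upper j j) // !eqxx !mulr1z.
  rewrite (f_central (L i j)) big1 ?addr0 // => k /andP[ki kj].
  have [lt_kj|le_jk] := ltnP k j.
    by rewrite [L k j]L_upper ?(ltnW lt_kj) // (negPf kj) mulr0z rng_mulr0.
  have [lt_ki|le_ik] := ltnP k i.
    have lt_jk : (j < k)%N by rewrite ltn_neqAle le_jk andbT eq_sym.
    by rewrite [L k j]IHd ?rng_mulr0 //; lia.
  by rewrite [L i k]L_upper // eq_sym (negPf ki) mulr0z rng_mul0.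
have fL0 : (f * L i j)%g = 0.
  have := congr1 (fun x => (f * x)%g) L2; rewrite rng_mulDr mulgA f_idem.
  by move/eqP; rewrite -subr_eq subrr eq_sym => /eqP.
by rewrite L2 fL0 addr0.
Qed.

(** Take for rho the powers U ^ phi g of a Jordan block, so that the sum of the
    c g *~ U ^ phi g is f times the identity. Multiplying by a large power U ^ B
    turns the exponents into naturals e g; let k be the largest of them, so that
    B < k if phi is positive somewhere. In row k of the first column, the left side
    is then the sum of the c g with e g = k, and the right side f times an entry of
    U ^ B, which is 0 as B < k. *)
Lemma character_le0 (phi : G -> int) :
    {in s &, {morph phi : g h / (g * h)%g >-> g + h}} ->
  {in s, forall g, phi g <= 0}.
Proof.
move=> phiM g0 g0s; rewrite leNgt; apply/negP => phi_gt0.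
pose B := (\sum_(g <- s) absz (phi g))%N.
pose e g := absz (phi g + B%:Z).
have eE g : g \in s -> (e g : int) = phi g + B%:Z.
  move=> gs; rewrite /e gez0_abs // /B (big_rem g) //=; lia.
have [k [/asboolP[g1 g1s e_g1] k_max]] : exists k, `[< exists2 g, g \in s & e g = k >] /\
    forall g, g \in s -> (e g <= k)%N.
  have ex : exists k, `[< exists2 g, g \in s & e g = k >].
    by exists (e g0); apply/asboolP; exists g0.
  have ub k : `[< exists2 g, g \in s & e g = k >] -> (k <= \max_(g <- s) e g)%N.
    by move=> /asboolP[g gs <-]; apply: leq_bigmax_seq.
  case: (ex_maxnP ex ub) => k kP k_max; exists k; split=> // g gs.
  by apply: k_max; apply/asboolP; exists g.
have lt_Bk : (B < k)%N by have := k_max g0 g0s; have := eE g0 g0s; lia.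
pose U := jordan k.+1.
have UU : U \is a GRing.unit by apply/unitriangular_unit/unitriangular_jordan.
pose rho g := U ^ phi g.
have L_diag := @unitriangular_idempotent _ rho.
have {}L_diag i j : \sum_(g <- s) c g *~ rho g i j = f *~ (i == j)%:R.
  apply: L_diag => [g h gs hs|g gs]; first by rewrite /rho phiM // exprzDr.
  exact/unitriangular_expz/unitriangular_jordan.
have top0 : \sum_(g <- s) c g *~ (e g == k)%:R = 0.
  (* Entry (k, 0) of the product of the matrix of sums by U ^+ B. *)
  transitivity (\sum_j (\sum_(g <- s) c g *~ rho g ord_max j) *~ (U ^+ B) j ord0).
    transitivity (\sum_(g <- s) \sum_j c g *~ (rho g ord_max j * (U ^+ B) j ord0)).
      rewrite big_seq [RHS]big_seq; apply: eq_bigr => g gs.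
      rewrite -mulrz_sumr; congr (_ *~ _).
      have -> : (e g == k)%:R = (U ^+ e g) ord_max ord0.
        by rewrite jordan_expr ?(k_max g gs) // eq_sym.
      have -> : U ^+ e g = rho g *m U ^+ B; last by rewrite mxE.
      by rewrite exprnP (eE g gs) exprzDr.
    rewrite exchange_big /=; apply: eq_bigr => j _; rewrite mulrz_suml.
    by apply: eq_bigr => g _; rewrite mulrzA.
  under eq_bigr => j _ do rewrite L_diag.
  rewrite (bigD1 ord_max) //= big1 ?addr0 => [|j jk].
    by rewrite eqxx mulr1z jordan_expr ?(ltnW lt_Bk) // gtn_eqF // mulr0z.
  by rewrite eq_sym (negPf jk) mulr0z mul0rz.
have /sP/eqP[] := g1s.
(* The weight that selects the degree g1. *)
have := congr1 (weighted A (fun h => (h == g1)%:R)) top0.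
rewrite weighted_sum // weighted0 // (bigD1_seq g1) //= big1 ?addr0 => [|g gg1].
  rewrite e_g1 eqxx mulr1z (weighted_homogeneous grA _ (component_graded grA f g1)).
  by rewrite eqxx.
have Ag : A g (c g *~ (e g == k)%:R).
  by case: (e g == k); [exact: component_graded | exact: graded0].
by rewrite (weighted_homogeneous grA _ Ag) (negPf gg1).
Qed.

Lemma character_trivial (phi : G -> int) :
    {in s &, {morph phi : g h / (g * h)%g >-> g + h}} ->
  {in s, forall g, phi g = 0}.
Proof.
move=> phiM g gs; apply: le_anti; apply/andP; split.
  exact: character_le0.
rewrite -oppr_le0; apply: (@character_le0 (fun g => - phi g)) => //.
by move=> x y xs ys /=; rewrite phiM // opprD.
Qed.

End CentralIdempotents.

(** * Finiteness of the support group *)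

Section SupportConjugation.
Variables (G : groupType) (R : rngType) (A : G -> set R).
Hypothesis grA : is_grading A.

Lemma mull_image_neq0 r g : [set (a * r)%g | a in A g] <> [set 0] ->
  exists2 a, A g a & (a * r)%g <> 0.
Proof.
move=> neq; apply: contrapT => no_a; apply: neq; apply/seteqP; split=> [_ [a Aa <-]|_ ->].
  by apply: contrapT => ar0; apply: no_a; exists a.
by exists 0; [exact: graded0 | exact: rng_mul0].
Qed.

Lemma mulr_image_neq0 r g : [set (r * a)%g | a in A g] <> [set 0] ->
  exists2 a, A g a & (r * a)%g <> 0.
Proof.
move=> neq; apply: contrapT => no_a; apply: neq; apply/seteqP; split=> [_ [a Aa <-]|_ ->].
  by apply: contrapT => ar0; apply: no_a; exists a.
by exists 0; [exact: graded0 | exact: rng_mulr0].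
Qed.

(** If f_h * a = a * f_(h ^ g) is nonzero for some a in A g, then both h and h ^ g
    belong to the support. The right-hand version of the nondegeneracy gives such
    an a for each h in the support, the left-hand version for each h ^ g; in the
    second case the support is stable under the inverse conjugation, which
    suffices by finiteness. *)
Lemma support_conj (f : R) (s : seq G) :
    (forall (r : R) (g : G), r <> 0 -> homogeneous A r -> ring_support A g ->
         [set (a * r)%g | a in A g] <> [set 0]) \/
      (forall (r : R) (g : G), r <> 0 -> homogeneous A r -> ring_support A g ->
         [set (r * a)%g | a in A g] <> [set 0]) ->
    central f -> (forall g, g \in s <-> elt_support A f g) ->
  {in s, forall h g, ring_support A g -> (h ^ g)%g \in s}.
Proof.
move=> nondeg fC sP.
have neq0 h : h \in s -> component A f h <> 0 by move/sP/eqP.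
have hom h : homogeneous A (component A f h) by exists h; apply: component_graded.
case: nondeg => nondeg h hs g Rg.
  rewrite -[g]invgK; apply: conjV_mem hs => k ks.
  have [a Aa] := mull_image_neq0 (nondeg _ _ (neq0 k ks) (hom k) Rg).
  rewrite -[in component A f k](conjgKV g k) -(central_component grA _ fC Aa) => fa0.
  apply/sP/eqP => f0; apply: fa0.
  by rewrite f0 rng_mul0.
have [a Aa] := mulr_image_neq0 (nondeg _ _ (neq0 h hs) (hom h) Rg).
rewrite (central_component grA _ fC Aa) => af0; apply/sP/eqP => f0; apply: af0.
by rewrite f0 rng_mulr0.
Qed.

End SupportConjugation.

Theorem theorem2 (G : groupType) (R : rngType) (A : G -> set R)
    (grA : is_grading A)
    (A_nondeg :
      (forall (r : R) (g : G), r <> 0 -> homogeneous A r -> ring_support A g ->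
         [set (a * r)%g | a in A g] <> [set 0]) \/
      (forall (r : R) (g : G), r <> 0 -> homogeneous A r -> ring_support A g ->
         [set (r * a)%g | a in A g] <> [set 0]))
    (f : R) (f_neq0 : f <> 0) (f_central : central f)
    (f_idem : idempotent_elt f) :
  finite_set (support_group A f).
Proof.
have [s us sP] := finite_set_enum (finite_elt_support grA f).
have s_conj : {in s &, forall x y, (x ^ y)%g \in s}.
  move=> x y xs ys; apply: (support_conj grA A_nondeg f_central sP) => //.
  by apply: (@elt_support_ring_support _ _ _ grA f); apply/sP.
have -> : support_group A f = generated s.
  by rewrite /support_group; congr smallest; apply/seteqP; split=> g /sP.
apply: dietzmann => // g gs; apply: contrapT => no_n.
have [|phi [phiM]] := integer_character s_conj gs.
  move=> [//|n] gn1; case: no_n; by exists n.+1.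
rewrite (character_trivial grA f_central f_idem us sP _ gs) ?eqxx //.
by move=> x y xs ys; apply: phiM; apply: mem_generated.
Qed.
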